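(* Let $n$ be an integer and let \[ L(n) = p(n) + \sum_{j\geq 1} (-1)^j \Big( p\big(n - j(5j-3)/2\big) + p\big(n-j(5j+3)/2\big) \Big) = p(n) - p(n-1) - p(n-4) + p(n-7) + p(n-13) - p(n-18) - p(n-27) + \cdots. \] For $i\in\mathbb{Z}$ put \[ r^e_i = 60i^2-8i,\quad r^o_i = 60i^2+52i+11,\quad s^e_i = 60i^2+32i+4,\quad s^o_i = 60i^2-28i+3 \] (these are respectively the even and odd terms of the sequence $15k^2-4k$, $k\in\mathbb{Z}$, and the even and odd terms of the sequence $15k^2-14k+3$, $k\in\mathbb{Z}$). If $n$ is even, then \[ L(n) = \sum_{i\in\mathbb{Z}} \left( p\!\left(\frac{n-r^e_i}{2}\right) - p\!\left(\frac{n-s^e_i}{2}\right)\right), \] and if $n$ is odd, then \[ L(n) = \sum_{i\in\mathbb{Z}} \left( -p\!\left(\frac{n-r^o_i}{2}\right) + p\!\left(\frac{n-s^o_i}{2}\right)\right). \]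
   Context: $p(m)$ denotes the number of partitions of the integer $m$, with $p(0)=1$ and $p(m)=0$ for $m<0$ (so all sums above are finite). *)

(* Defs.v *)
From mathcomp Require Import all_boot all_order all_algebra.
Set Implicit Arguments. Unset Strict Implicit. Unset Printing Implicit Defensive.
Import Order.TTheory GRing.Theory Num.Theory.
Local Open Scope ring_scope.

(* Partitions of m, represented as nonincreasing m-tuples of parts in [0, m]
   summing to m (a partition of m has at most m positive parts, padded by
   trailing zeros). *)
Definition is_partition (m : nat) (s : m.-tuple 'I_m.+1) : bool :=
  sorted geq (map (@nat_of_ord _) s) && (sumn (map (@nat_of_ord _) s) == m)%N.

Definition npart (m : nat) : nat := #|[pred s : m.-tuple 'I_m.+1 | is_partition s]|.

Definition p (z : int) : int :=
  match z with Posz m => (npart m)%:Z | Negz _ => 0 end.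

(* L(n), the sum over j >= 1 truncated to 1 <= j < N (all further terms vanish
   as soon as N > |n|). *)
Definition Lsum (n : int) (N : nat) : int :=
  p n + \sum_(1 <= j < N)
    (-1) ^+ j * (p (n - divz (j%:Z * (5 * j%:Z - 3)) 2)
                 + p (n - divz (j%:Z * (5 * j%:Z + 3)) 2)).

Definition re (i : int) : int := 60 * i ^+ 2 - 8 * i.
Definition ro (i : int) : int := 60 * i ^+ 2 + 52 * i + 11.
Definition se (i : int) : int := 60 * i ^+ 2 + 32 * i + 4.
Definition so (i : int) : int := 60 * i ^+ 2 - 28 * i + 3.

Definition zsum (N : nat) (F : int -> int) : int :=
  \sum_(k < (2 * N).+1) F (k%:Z - N%:Z).

(* Main.v *)
Require Import Defs.
From mathcomp Require Import all_boot all_order all_algebra.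
From mathcomp Require Import zify ring.
Import Order.TTheory GRing.Theory Num.Theory.
Local Open Scope ring_scope.
Set Implicit Arguments. Unset Strict Implicit. Unset Printing Implicit Defensive.

(* L(n) is the coefficient of x^n in P(x) f(-x,-x^4), where P(x) = sum p(m) x^m and
   f(u,v) = sum_j u^(j(j+1)/2) v^(j(j-1)/2) is Ramanujan's theta function; the right-hand
   sides, for n even and n odd together, are the coefficients of P(x^2) Q(x) with
   Q(x) = sum_k (-1)^k (x^(15k^2-4k) + x^(15k^2-14k+3)).  By the Jacobi triple product,
   f(-x,-x^4), f(x^7,x^3), f(-x^4,-x^16) and f(-x^20,-x^40) are infinite products, and
   comparing the exponents of 1 - x^m for m modulo 60 gives
     f(-x,-x^4) f(-x^20,-x^40) / P(x^2) = f(x^7,x^3) f(-x^4,-x^16) / P(x).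
   On the other hand f(x^7,x^3) f(-x^4,-x^16) = Q(x) f(-x^20,-x^40), a case of the quintuple
   product identity: the substitution (m,n) = (a+2b, a-b) turns the form 5m^2 + 10n^2 into
   15a^2 + 30b^2, and of the three cosets of the sublattice so obtained two give the two
   halves of Q, while the third one contributes 0.  Cancelling f(-x^20,-x^40) gives the claim.

   Power series in x modulo x^K are modelled by an arbitrary commutative ring with an
   element x such that x^K = 0. *)

(** * Sums over finite ranges of integers, and triangular numbers *)

Lemma eq_big_supp (T : Type) (idx : T) (op : Monoid.com_law idx) (I : eqType)
    (s1 s2 : seq I) (F : I -> T) (Pn : pred I) :
  uniq s1 -> uniq s2 -> (forall i, ~~ Pn i -> F i = idx) ->
  (forall i, Pn i -> (i \in s1) = (i \in s2)) ->
  \big[op/idx]_(i <- s1) F i = \big[op/idx]_(i <- s2) F i.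
Proof.
move=> u1 u2 F0 E.
rewrite -(@big_rmcond _ _ op _ s1 Pn) // -(@big_rmcond _ _ op _ s2 Pn) //.
rewrite -(big_filter s1) -(big_filter s2); apply: perm_big.
apply: uniq_perm; rewrite ?filter_uniq // => i; rewrite !mem_filter.
by case: (boolP (Pn i)) => //= /E.
Qed.

Definition zrange (N : nat) : seq int := [seq k%:Z - N%:Z | k <- iota 0 (2 * N).+1].

Lemma zrange_uniq N : uniq (zrange N).
Proof. by rewrite map_inj_uniq ?iota_uniq // => a b; lia. Qed.

Lemma mem_zrange N (z : int) : (z \in zrange N) = (absz z <= N)%N.
Proof.
apply/mapP/idP => [[k]|h]; first by rewrite mem_iota => *; lia.
by exists (absz (z + N%:Z)); rewrite ?mem_iota; lia.
Qed.

(** The number j(j+1)/2 as a natural number, fit to be an exponent. Since [Negz n] is -(n+1), both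
    branches are n(n+1)/2. *)
Definition tri (j : int) : nat :=
  match j with Posz n => 'C(n.+1, 2) | Negz n => 'C(n.+1, 2) end.

Lemma triE (j : int) : 2 * (tri j)%:Z = j * (j + 1).
Proof.
have E n : (2 * 'C(n.+1, 2) = n.+1 * n)%N by elim: n => // n IH; rewrite binS bin1; nia.
case: j => n /=; have := E n; nia.
Qed.

(** * Finite triple product *)

Lemma tri_succ (j : int) : (tri (j + 1))%:Z = (tri j)%:Z + j + 1.
Proof. by have := triE j; have := triE (j + 1); nia. Qed.

(** Gaussian binomial coefficients, by a q-Pascal rule because [R] offers no quotients. The
    truncation of [n - k] is harmless: for k > n its cofactor is 0. *)
Fixpoint qbin {R : comNzRingType} (q : R) (n k : nat) : R :=
  match n, k with
  | _, 0 => 1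
  | 0, _.+1 => 0
  | n.+1, k.+1 => qbin q n k.+1 + q ^+ (n - k) * qbin q n k
  end.

Section JacobiTripleProduct.
Variable R : comNzRingType.
Implicit Types (q u v : R).

Lemma qbin0 q n : qbin q n 0 = 1. Proof. by case: n. Qed.

Lemma qbinS q n k : qbin q n.+1 k.+1 = qbin q n k.+1 + q ^+ (n - k) * qbin q n k.
Proof. by []. Qed.

Lemma qbin_small q n k : (n < k)%N -> qbin q n k = 0.
Proof.
elim: n k => [|n IH] [|k] //= lt_nk.
by rewrite !IH ?mulr0 ?addr0 // ltnW.
Qed.

(** The other q-Pascal rule: it absorbs the factors in v of the triple product, as [qbinS] absorbs
    those in u. *)
Lemma qbinS_shift q n k : qbin q n.+1 k.+1 = q ^+ k.+1 * qbin q n k.+1 + qbin q n k.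
Proof.
elim: n k => [|n IH] [|k]; first by rewrite /= !mulr0 mulr1 expr0.
- by rewrite /= !mulr0 addr0.
- by rewrite qbinS {1}IH qbinS !qbin0 !subn0 !exprS; ring.
- rewrite qbinS {1}IH {1}(IH k) subSS [in RHS]qbinS [X in _ = _ + X]qbinS.
  have [lt_kn|le_nk] := ltnP k n; last first.
    rewrite (@qbin_small q n k.+1) ?(@qbin_small q n k.+2) //; [ring|lia].
  by rewrite (_ : (n - k = (n - k.+1).+1)%N) ?exprS; [ring|lia].
Qed.

Lemma qbin_diag q n : qbin q n n = 1.
Proof.
by elim: n => // n IH; rewrite qbinS IH subnn qbin_small // add0r mulr1.
Qed.

(** The q-Pochhammer symbol (a;q)_n. *)
Definition qpoch (a q : R) (n : nat) : R := \prod_(i < n) (1 - a * q ^+ i).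

Lemma qpochS a q n : qpoch a q n.+1 = qpoch a q n * (1 - a * q ^+ n).
Proof. by rewrite /qpoch big_ord_recr. Qed.

Lemma qbin_qpoch q r s :
  qbin q (r + s) r * (qpoch q q r * qpoch q q s) = qpoch q q (r + s).
Proof.
have [n] := ubnP (r + s); elim: n r s => // n IH [|r] [|s] lt_n.
- by rewrite /= /qpoch !big_ord0 !mulr1.
- by rewrite qbin0 add0n /qpoch big_ord0 !mul1r.
- by rewrite addn0 qbin_diag /qpoch big_ord0 mulr1 mul1r.
- rewrite addSn qbinS (_ : (r + s.+1 - r = s.+1)%N); last by lia.
  have E1 := IH r s.+1 ltac:(lia).
  have E2 := IH r.+1 s ltac:(lia).
  rewrite addSnnS in E2.
  (* Each Pascal summand receives the factor it lacks; the weights then add up to 1 - q^(s+1) +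
     q^(s+1) (1 - q^(r+1)) = 1 - q^(r+s+2). *)
  transitivity (qbin q (r + s.+1) r.+1 * (qpoch q q r.+1 * qpoch q q s) * (1 - q * q ^+ s)
    + q * q ^+ s * (1 - q * q ^+ r) * (qbin q (r + s.+1) r * (qpoch q q r * qpoch q q s.+1))).
    by rewrite !qpochS exprS; ring.
  by rewrite E1 E2 qpochS addnS exprS exprD; ring.
Qed.

Definition theta_term u v (j : int) : R := u ^+ tri j * v ^+ tri (- j).

(** Formally the term at j+1 is u(uv)^j times the term at j; as j may be negative, the power is
    spread over both sides as (uv)^n and (uv)^(n-j). *)
Lemma theta_term_up u v (n : nat) (j : int) (d : nat) : d%:Z = n%:Z - j ->
  u * (u * v) ^+ n * theta_term u v j = (u * v) ^+ d * theta_term u v (j + 1).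
Proof.
move=> dE; rewrite /theta_term !exprMn.
have h1 := tri_succ j; have := tri_succ (- (j + 1)).
have -> : - (j + 1) + 1 = - j by ring.
move=> h2.
have -> : u * (u ^+ n * v ^+ n) * (u ^+ tri j * v ^+ tri (- j)) =
   u ^+ (n + tri j).+1 * v ^+ (n + tri (- j)) by rewrite exprS !exprD; ring.
have -> : u ^+ d * v ^+ d * (u ^+ tri (j + 1) * v ^+ tri (- (j + 1))) =
   u ^+ (d + tri (j + 1)) * v ^+ (d + tri (- (j + 1))) by rewrite !exprD; ring.
by congr (_ ^+ _ * _ ^+ _); lia.
Qed.

Lemma theta_termC u v j : theta_term u v j = theta_term v u (- j).
Proof. by rewrite /theta_term opprK mulrC. Qed.

Lemma theta_term_down u v (n : nat) (j : int) (d : nat) : d%:Z = n%:Z + j ->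
  v * (u * v) ^+ n * theta_term u v j = (u * v) ^+ d * theta_term u v (j - 1).
Proof.
move=> dE; rewrite (theta_termC u v j) (theta_termC u v (j - 1)) (mulrC u v).
rewrite (@theta_term_up v u n (- j) d); last by lia.
by congr (_ * theta_term _ _ _); ring.
Qed.

(** A symmetric q-binomial theorem. Induction on n absorbs each new factor 1 + u(uv)^n by [qbinS];
    the case n = 0 is an induction on m by [qbinS_shift]. *)
Lemma finite_triple_product u v n m :
  qpoch (- u) (u * v) n * qpoch (- v) (u * v) m =
  \sum_(k < (n + m).+1) qbin (u * v) (n + m) k * theta_term u v (k%:Z - m%:Z).
Proof.
set q := u * v.
elim: n => [|n IHn]; last first.
  rewrite addSn big_ord_recl qbin0 mul1r /=.
  under eq_bigr => k _.
    rewrite -[qbin _ _ _ + _]/(qbin q (n + m).+1 k.+1) qbinS mulrDl -mulrA.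
    rewrite (_ : q ^+ _ * (_ * _) = u * q ^+ n * (qbin q (n + m) k * theta_term u v (k%:Z - m%:Z))).
    over.
    rewrite mulrCA (_ : (bump 0 k)%:Z - m%:Z = k%:Z - m%:Z + 1); last by rewrite /bump; lia.
    rewrite -(@theta_term_up u v n); first ring.
    have := ltn_ord k; lia.
  rewrite big_split /= -big_distrr -IHn addrA.
  have := big_ord_recl (n + m).+1 (fun k : 'I_ _ => qbin q (n + m) k * theta_term u v (k%:Z - m%:Z)).
  rewrite /= qbin0 mul1r => <-.
  rewrite big_ord_recr /= qbin_small // mul0r addr0 -IHn qpochS.
  ring.
elim: m => [|m IHm].
  by rewrite big_ord_recr big_ord0 /= /qpoch !big_ord0 /theta_term /= /tri /= !mulr1 add0r.
rewrite !add0n in IHm *.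
rewrite big_ord_recl qbin0 mul1r /=.
under eq_bigr => k _.
  rewrite -[qbin _ _ _ + _]/(qbin q m.+1 k.+1) qbinS_shift mulrDl.
  rewrite [X in _ + qbin q m k * theta_term u v X](_ : _ = k%:Z - m%:Z); last by rewrite /bump; lia.
  over.
rewrite big_split /= -IHm addrA.
have := big_ord_recl m.+1 (fun k : 'I_ _ => q ^+ k * qbin q m k * theta_term u v (k%:Z - m.+1%:Z)).
rewrite /= qbin0 expr0 !mul1r => <-.
rewrite big_ord_recr /= qbin_small // mulr0 mul0r addr0 qpochS.
under eq_bigr => k _.
  rewrite (_ : _ * _ = v * q ^+ m * (qbin q m k * theta_term u v (k%:Z - m%:Z))).
  over.
  rewrite [RHS]mulrCA (@theta_term_down u v m _ k); last by lia.
  rewrite (_ : k%:Z - m%:Z - 1 = k%:Z - m.+1%:Z); last by lia.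
  by rewrite -/q; ring.
rewrite -big_distrr -IHm /=; ring.
Qed.
End JacobiTripleProduct.

(** * Jacobi triple product *)

Section NilpotentTripleProduct.
Variables (R : comNzRingType) (K : nat).
Implicit Types (a q u v y : R).

Lemma expr_nil y i : y ^+ K = 0 -> (K <= i)%N -> y ^+ i = 0.
Proof. by move=> y0 le_Ki; rewrite -(subnK le_Ki) exprD y0 mulr0. Qed.

(** The geometric series inverts 1 - y. Cancelling such factors replaces division of power
    series. *)
Lemma lreg_sub1_nil y : y ^+ K = 0 -> GRing.lreg (1 - y).
Proof.
move=> y0 a b /= E.
have G : (1 - y) * \sum_(i < K) y ^+ i = 1 by rewrite -[in 1 - y](opprB y 1) mulNr -subrX1 y0; ring.
by rewrite -[a]mul1r -[b]mul1r -G [_ * \sum_(i < K) _]mulrC -!mulrA E.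
Qed.

Lemma lreg_qpoch a q n (a0 : a ^+ K = 0) : GRing.lreg (qpoch a q n).
Proof.
rewrite /qpoch; elim/big_ind: _ => [|b c|i _]; first exact: lreg1.
  exact: lregM.
by apply: lreg_sub1_nil; rewrite exprMn a0 mul0r.
Qed.

Lemma qpoch_stable a q n : q ^+ K = 0 -> (K <= n)%N -> qpoch a q n = qpoch a q K.
Proof.
move=> q0; elim: n => [|n IH]; first by case: K.
rewrite leq_eqVlt => /predU1P[-> //|lt_Kn].
by rewrite qpochS (expr_nil q0) // mulr0 subr0 mulr1 IH.
Qed.

(* Ramanujan's f(u,v), when [u] and [v] vanish to a power at most [N]. *)
Definition theta u v N : R := \sum_(j <- zrange N) theta_term u v j.

Lemma theta_term_nil u v j : u ^+ K = 0 -> v ^+ K = 0 -> (K <= absz j)%N ->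
  theta_term u v j = 0.
Proof.
move=> u0 v0 le_Kj; rewrite /theta_term.
have := triE j; have := triE (- j).
have [j0|j0] := leP 0 j => E1 E2.
  by rewrite (expr_nil u0) ?mul0r //; nia.
by rewrite (expr_nil v0) ?mulr0 //; nia.
Qed.

(** Take both lengths equal to 2K in the finite product, with q = uv. For |j| < K the three symbols
    in [qbin_qpoch] have length at least K, so all equal (q;q)_K, and the q-binomial times (q;q)_K
    is 1. For |j| >= K the theta term is 0. *)
Theorem jacobi_triple_product u v N n : u ^+ K = 0 -> v ^+ K = 0 ->
  (K <= N)%N -> (K <= n)%N ->
  theta u v N = qpoch (- u) (u * v) n * qpoch (- v) (u * v) n * qpoch (u * v) (u * v) n.
Proof.
move=> u0 v0 le_KN le_Kn.
have q0 : (u * v) ^+ K = 0 by rewrite exprMn u0 mul0r.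
have st a i : (K <= i)%N -> qpoch a (u * v) i = qpoch a (u * v) K by exact: qpoch_stable.
rewrite (st _ n) // (st _ n) // (st _ n) //.
have le2 : (K <= 2 * K)%N by lia.
rewrite -(st (- u) _ le2) -(st (- v) _ le2) finite_triple_product big_distrl /=.
transitivity (theta u v (2 * K)).
  apply: (@eq_big_supp _ _ _ _ _ _ _ (fun j => absz j < K)%N); rewrite ?zrange_uniq // => j.
    by rewrite -leqNgt; apply: theta_term_nil.
  by rewrite !mem_zrange; lia.
rewrite /theta big_map -[iota _ _]/(index_iota 0 (2 * (2 * K)).+1) big_mkord.
rewrite (_ : (2 * (2 * K) = 2 * K + 2 * K)%N); last by lia.
apply: eq_bigr => k _; rewrite mulrAC -[LHS]mul1r.
have [le_K|lt_K] := leqP K (absz (k%:Z - (2 * K)%N%:Z)).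
  by rewrite (theta_term_nil u0 v0 le_K) !mulr0.
congr (_ * _); have C := @lreg_qpoch _ (u * v) K q0; apply: C.
have := qbin_qpoch (u * v) k (2 * K + 2 * K - k).
have lek := ltn_ord k.
rewrite subnKC // !(st (u * v)); try lia.
by rewrite mulr1 => E; rewrite -[LHS]E; ring.
Qed.

Lemma qpochN_mul a q n : qpoch (- a) q n * qpoch a q n = qpoch (a ^+ 2) (q ^+ 2) n.
Proof.
rewrite /qpoch -big_split; apply: eq_bigr => i _ /=.
by rewrite -exprM mulnC exprM; ring.
Qed.

(** Indexing factors by a residue class lets products with different moduli be compared factor by
    factor. *)
Lemma qpoch_residue (x : R) (a b n : nat) : x ^+ K = 0 -> (0 < a <= b)%N -> (K <= n)%N ->
  qpoch (x ^+ a) (x ^+ b) n =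
  \prod_(1 <= m < K | (m %% b == a %% b)%N) (1 - x ^+ m).
Proof.
move=> x0 /andP[a0 le_ab] le_Kn.
rewrite /qpoch -(big_mkord xpredT (fun i => 1 - x ^+ a * (x ^+ b) ^+ i)).
under eq_bigr => i _ do rewrite -exprM -exprD.
rewrite -(big_map (fun i => a + b * i)%N xpredT (fun m => 1 - x ^+ m)) -[RHS]big_filter.
apply: (@eq_big_supp _ _ _ _ _ _ _ (fun m => m < K)%N).
- by rewrite map_inj_uniq ?iota_uniq // => i j; nia.
- by rewrite filter_uniq ?iota_uniq.
- by move=> m; rewrite -leqNgt => le_Km; rewrite (expr_nil x0) // subr0.
move=> m lt_mK; rewrite mem_filter mem_index_iota lt_mK andbT.
apply/mapP/andP => [[i _ ->]|[/eqP E m0]].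
  by rewrite mulnC addnC modnMDl eqxx; lia.
(* [a] is the least positive member of its class, also when a = b. *)
have le_am : (a <= m)%N.
  rewrite leqNgt; apply/negP => lt_ma; move: E; rewrite modn_small; last lia.
  by move: le_ab; rewrite leq_eqVlt => /predU1P[->|?]; rewrite ?modnn ?modn_small //; lia.
have /dvdnP[i Ei] : (b %| m - a)%N by rewrite -eqn_mod_dvd //; apply/eqP.
exists i; last by lia.
by rewrite mem_index_iota /=; nia.
Qed.
End NilpotentTripleProduct.

(** * Quintuple product *)

Definition zbox (N : nat) : seq (int * int) :=
  [seq (a, b) | a <- zrange N, b <- zrange N].

Lemma mem_zbox N (c : int * int) :
  (c \in zbox N) = (absz c.1 <= N)%N && (absz c.2 <= N)%N.
Proof.
case: c => a b /=; apply/allpairsP/andP => [[[a' b']] /= [ha hb [-> ->]]|[ha hb]].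
  by rewrite -!mem_zrange.
by exists (a, b); rewrite /= !mem_zrange.
Qed.

Lemma zbox_uniq N : uniq (zbox N).
Proof. by apply: allpairs_uniq; rewrite ?zrange_uniq // => -[a b] [c d] _ _ [-> ->]. Qed.

Lemma sign_even (R : pzRingType) (m n d : int) : m = n + 2 * d ->
  (-1) ^+ absz m = (-1) ^+ absz n :> R.
Proof. by move=> E; rewrite -signr_odd -[RHS]signr_odd; congr (_ ^+ nat_of_bool _); lia. Qed.

Lemma sign_odd (R : pzRingType) (m n d : int) : m = n + 2 * d + 1 ->
  (-1) ^+ absz m = - (-1) ^+ absz n :> R.
Proof.
move=> E; rewrite -signr_odd -[in RHS]signr_odd (_ : odd (absz m) = ~~ odd (absz n)) ?signrN //.
lia.
Qed.

Arguments zbox : simpl never.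

Section ThetaQuotient.
Variables (R : comNzRingType) (K : nat) (x : R).
Hypothesis x_nil : x ^+ K = 0.

Lemma theta_term_expX (a b : nat) j :
  theta_term (x ^+ a) (x ^+ b) j = x ^+ (a * tri j + b * tri (- j)).
Proof. by rewrite /theta_term -!exprM -exprD. Qed.

Lemma theta_term_expNX (a b : nat) j :
  theta_term (- x ^+ a) (- x ^+ b) j =
  (-1) ^+ absz j * x ^+ (a * tri j + b * tri (- j)).
Proof.
rewrite /theta_term (exprNn (x ^+ a)) (exprNn (x ^+ b)) -!exprM.
rewrite mulrACA -!exprD (_ : (tri j + tri (- j) = absz j * absz j)%N).
  by congr (_ * _); rewrite -[LHS]signr_odd oddM andbb signr_odd.
have sq : (absz j)%:Z * (absz j)%:Z = j * j by nia.
by have := triE j; have := triE (- j); nia.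
Qed.

(** The series Q(x) with k split by parity: [re] and [so] come from k = 2i, [ro] and [se] from k =
    2i+1. *)
Definition quintuple_sum N : R :=
  \sum_(i <- zrange N) (x ^+ absz (re i) - x ^+ absz (se i) - x ^+ absz (ro i) + x ^+ absz (so i)).

(** The exponent 7m(m+1)/2 + 3m(m-1)/2 + 4n(n+1)/2 + 16n(n-1)/2 of a term of the product of the two
    theta series. *)
Let ex (c : int * int) : int := 5 * c.1 ^+ 2 + 2 * c.1 + 10 * c.2 ^+ 2 - 6 * c.2.
Let F c : R := (-1) ^+ absz c.2 * x ^+ absz (ex c).

Lemma theta_mul_eq : theta (x ^+ 7) (x ^+ 3) K * theta (- x ^+ 4) (- x ^+ 16) K =
  \sum_(c <- zbox K) F c.
Proof.
rewrite /theta big_distrl [RHS]big_allpairs; apply: eq_bigr => m _.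
rewrite big_distrr; apply: eq_bigr => n _ /=.
rewrite theta_term_expX theta_term_expNX mulrCA -exprD; congr (_ * _ ^+ _).
rewrite /ex /=.
have := triE m; have := triE (- m); have := triE n; have := triE (- n); nia.
Qed.

(* (m,n) = (a+2b, a-b), (a-2b, a+b+1) and (a+2b, a-b-1), with a = 2i or 2i+1 (2i or 2i-1)
   in the first two families; in the last one b and -1-b give opposite terms. *)
Let h (k : nat) (c : int * int) : int * int :=
  let: (i, b) := c in
  match k with
  | 0 => (2 * i + 2 * b, 2 * i - b)
  | 1 => (2 * i + 1 + 2 * b, 2 * i + 1 - b)
  | 2 => (2 * i - 2 * b, 2 * i + b + 1)
  | 3 => (2 * i - 1 - 2 * b, 2 * i + b)
  | 4 => (i + 2 * b, i - b - 1)
  | _ => (i - 2 * b - 2, i + b)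
  end.

Lemma h_inj k : injective (h k).
Proof. case: k => [|[|[|[|[|k]]]]] [a b] [c d] [] *; congr (_, _); lia. Qed.

(** Confines the nonzero terms, and their preimages under [h], to the box of radius K. *)
Lemma ex_bound c : 3 * (absz c.1)%:Z + 4 * (absz c.2)%:Z <= ex c.
Proof. 
case: c => m n; rewrite /ex /= !expr2.
have h1 (z : int) : (absz z)%:Z <= z * z by nia.
have := h1 m; have := h1 n; lia.
Qed.

Lemma lattice_split : \sum_(c <- zbox K) F c =
  \sum_(c <- zbox K) (F (h 0 c) + F (h 1 c) + F (h 2 c) + F (h 3 c)).
Proof.
have split_sum (s t : seq (int * int)) :
    \sum_(c <- map (h 0) s ++ map (h 1) s ++ map (h 2) s ++ map (h 3) s ++ map (h 4) t ++ map (h 5) t) F c =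
    \sum_(c <- s) (F (h 0 c) + F (h 1 c) + F (h 2 c) + F (h 3 c)) +
    \sum_(c <- t) (F (h 4 c) + F (h 5 c)).
  by rewrite !big_cat !big_map !big_split /= !addrA.
have split_uniq (s t : seq (int * int)) : uniq s -> uniq t -> (forall c, c \in t -> 0 <= c.2) ->
    uniq (map (h 0) s ++ map (h 1) s ++ map (h 2) s ++ map (h 3) s ++ map (h 4) t ++ map (h 5) t).
  { move=> us ut t0.
  have disj k l (s1 s2 : seq (int * int)) :
      (forall c d, c \in s1 -> d \in s2 -> h k c <> h l d) ->
      has [in map (h k) s1] (map (h l) s2) = false.
    move=> ne; apply/hasP => -[_ /mapP[d Cd ->] /mapP[c Cc]] /esym; exact: ne.
  rewrite !cat_uniq !(map_inj_uniq (@h_inj _)) us ut !has_cat !disj //=.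
  all: move=> [a b] [c d] C D; try (have /= ? := t0 _ C); try (have /= ? := t0 _ D); case; lia. }
(* [h 5] is [h 4] after b -> -1-b, so with b >= 0 these two families cover the third coset exactly
   once. *)
pose pos := [seq c : int * int <- zbox K | 0 <= c.2].
have ex_lt (c : int * int) : (absz (ex c) < K)%N -> (3 * absz c.1 + 4 * absz c.2 < K)%N.
  by move: (ex_bound c); move: (ex c) => e; lia.
have cover (m n : int) : (3 * absz m + 4 * absz n < K)%N -> (m, n) \in
    map (h 0) (zbox K) ++ map (h 1) (zbox K) ++
    map (h 2) (zbox K) ++ map (h 3) (zbox K) ++ map (h 4) pos ++ map (h 5) pos.
  move=> bnd; rewrite !mem_cat.
  have mem_h k c (s : seq (int * int)) : c \in s -> h k c = (m, n) -> (m, n) \in map (h k) s.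
    by move=> Cc <-; apply: map_f.
  have mem_pos a b : (absz a <= K)%N -> (absz b <= K)%N -> 0 <= b -> (a, b) \in pos.
    by move=> *; rewrite mem_filter mem_zbox /=; apply/and3P.
  (* The class of m - n modulo 3 selects the coset; then the parity of m - 2d, or the sign of d in
     the third coset, selects the family. *)
  have [[d Ed]|[[d Ed]|[d Ed]]] : (exists d, m = n + 3 * d) \/ (exists d, m = n + 3 * d + 1)
      \/ (exists d, m = n + 3 * d - 1).
  - have [E|[E|E]] : (m - n = 3 * divz (m - n) 3 \/ m - n = 3 * divz (m - n) 3 + 1 \/
       m - n = 3 * divz (m - n + 1) 3 - 1) by lia.
    + by left; exists (divz (m - n) 3); lia.
    + by right; left; exists (divz (m - n) 3); lia.
    + by right; right; exists (divz (m - n + 1) 3); lia.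
  - have [E|E] : (m - 2 * d = 2 * divz (m - 2 * d) 2 \/ m - 2 * d = 2 * divz (m - 2 * d) 2 + 1) by lia.
    + rewrite (mem_h 0 (divz (m - 2 * d) 2, d)) // ?mem_zbox /=; try (congr (_, _)); lia.
    + rewrite (mem_h 1 (divz (m - 2 * d) 2, d)) ?orbT // ?mem_zbox /=; try (congr (_, _)); lia.
  - have [b0|b0] := leP 0 d.
    + rewrite (mem_h 4 (m - 2 * d, d)) ?orbT // ?mem_pos //=; try (congr (_, _)); lia.
    + rewrite (mem_h 5 (m - 2 * d, - d - 1)) ?orbT // ?mem_pos //=; try (congr (_, _)); lia.
  - have [E|E] : (m - 2 * d = 2 * divz (m - 2 * d) 2 \/ m - 2 * d = 2 * divz (m - 2 * d + 1) 2 - 1) by lia.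
    + rewrite (mem_h 2 (divz (m - 2 * d) 2, - d)) ?orbT // ?mem_zbox /=; try (congr (_, _)); lia.
    + rewrite (mem_h 3 (divz (m - 2 * d + 1) 2, - d)) ?orbT // ?mem_zbox /=; try (congr (_, _)); lia.
transitivity (\sum_(c <- map (h 0) (zbox K) ++ map (h 1) (zbox K) ++
   map (h 2) (zbox K) ++ map (h 3) (zbox K) ++ map (h 4) pos ++ map (h 5) pos) F c); last first.
  (* The families [h 4] and [h 5] cancel: equal exponents, second coordinates of opposite parity. *)
  rewrite split_sum -[RHS]addr0; congr (_ + _); rewrite big1 // => -[a b] _ /=.
  rewrite /F /ex /= (@sign_odd _ _ (a + b) (- b - 1)); last by ring.
  rewrite mulNr addrC; apply/eqP; rewrite subr_eq0; apply/eqP.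
  by congr (_ * _ ^+ absz _); ring.
apply: (@eq_big_supp _ _ _ _ _ _ _ (fun c => absz (ex c) < K)%N).
- exact: zbox_uniq.
- apply: split_uniq; rewrite ?filter_uniq ?zbox_uniq // => c.
  by rewrite mem_filter => /andP[].
- by move=> c; rewrite -leqNgt => le; rewrite /F (expr_nil x_nil le) mulr0.
case=> m n /ex_lt bnd; rewrite cover // mem_zbox /=.
by apply/andP; split; move: bnd => /=; lia.
Qed.

(** On each remaining family [ex] separates into an exponent of Q depending on i and 30b^2 + 10b,
    the exponent of f(-x^40,-x^20) at b; the signs separate likewise. *)
Lemma theta_lattice :
  theta (x ^+ 7) (x ^+ 3) K * theta (- x ^+ 4) (- x ^+ 16) K =
  quintuple_sum K * theta (- x ^+ 40) (- x ^+ 20) K.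
Proof.
rewrite theta_mul_eq lattice_split big_allpairs /quintuple_sum big_distrl.
apply: eq_bigr => i _; rewrite big_distrr; apply: eq_bigr => b _.
rewrite theta_term_expNX; set E := (_ * tri b + _)%N.
have EE : E%:Z = 30 * b ^+ 2 + 10 * b.
  by rewrite /E; have := triE b; have := triE (- b); nia.
have FhE k f : ex (h k (i, b)) = f + E%:Z -> 0 <= f ->
    F (h k (i, b)) = (-1) ^+ absz (h k (i, b)).2 * (x ^+ absz f * x ^+ E).
  by rewrite /F => -> f0; rewrite -exprD; congr (_ * _ ^+ _); lia.
have i2 : `|i| <= i ^+ 2 by nia.
rewrite (FhE 0 (re i)); [|by rewrite EE /ex /re /=; ring|by rewrite /re; lia].
rewrite (FhE 1 (ro i)); [|by rewrite EE /ex /ro /=; ring|by rewrite /ro; lia].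
rewrite (FhE 2 (se i)); [|by rewrite EE /ex /se /=; ring|by rewrite /se; lia].
rewrite (FhE 3 (so i)); [|by rewrite EE /ex /so /=; ring|by rewrite /so; lia].
rewrite [(h 0 _).2]/= [(h 1 _).2]/= [(h 2 _).2]/= [(h 3 _).2]/=.
rewrite (@sign_even _ (2 * i - b) b (i - b)); last by ring.
rewrite (@sign_odd _ (2 * i + 1 - b) b (i - b)); last by ring.
rewrite (@sign_odd _ (2 * i + b + 1) b i); last by ring.
rewrite (@sign_even _ (2 * i + b) b i); last by ring.
move: (_ ^+ absz (re i)) (_ ^+ absz (ro i)) (_ ^+ absz (se i)) (_ ^+ absz (so i)) => r0 r1 r2 r3.
move: (_ ^+ absz b) (_ ^+ E) => t0 t1.
by rewrite /=; ring.
Qed.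

End ThetaQuotient.

(** * Product identity *)

Section ThetaProduct.
Variables (R : comNzRingType) (K : nat) (x : R).
Hypothesis x_nil : x ^+ K = 0.

Lemma expX_nil d : (0 < d)%N -> (x ^+ d) ^+ K = 0.
Proof. by move=> d0; rewrite -exprM mulnC exprM x_nil expr0n; case: d d0. Qed.

Lemma expNX_nil d : (0 < d)%N -> (- x ^+ d) ^+ K = 0.
Proof. by move=> d0; rewrite exprNn expX_nil ?mulr0. Qed.

Lemma theta_neg a b : (0 < a)%N -> (0 < b)%N ->
  theta (- x ^+ a) (- x ^+ b) K =
  qpoch (x ^+ a) (x ^+ (a + b)) K * qpoch (x ^+ b) (x ^+ (a + b)) K *
  qpoch (x ^+ (a + b)) (x ^+ (a + b)) K.
Proof.
move=> a0 b0; rewrite (@jacobi_triple_product _ K _ _ _ K) ?expNX_nil //.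
by rewrite !opprK mulrNN -exprD.
Qed.

(** Multiplying by the matching symbols turns each 1 + y into 1 - y^2, so only factors 1 - x^m
    remain. *)
Lemma theta_pos a b : (0 < a)%N -> (0 < b)%N ->
  theta (x ^+ a) (x ^+ b) K *
    (qpoch (x ^+ a) (x ^+ (a + b)) K * qpoch (x ^+ b) (x ^+ (a + b)) K) =
  qpoch (x ^+ (a * 2)) (x ^+ ((a + b) * 2)) K * qpoch (x ^+ (b * 2)) (x ^+ ((a + b) * 2)) K *
  qpoch (x ^+ (a + b)) (x ^+ (a + b)) K.
Proof.
move=> a0 b0; rewrite (@jacobi_triple_product _ K _ _ _ K) ?expX_nil //.
by rewrite -exprD !exprM -!qpochN_mul; ring.
Qed.

Lemma theta_product :
  theta (- x ^+ 1) (- x ^+ 4) K * qpoch (x ^+ 2) (x ^+ 2) K * theta (- x ^+ 40) (- x ^+ 20) K =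
  theta (x ^+ 7) (x ^+ 3) K * theta (- x ^+ 4) (- x ^+ 16) K * qpoch (x ^+ 1) (x ^+ 1) K.
Proof.
pose c := qpoch (x ^+ 7) (x ^+ (7 + 3)) K * qpoch (x ^+ 3) (x ^+ (7 + 3)) K.
have lc : GRing.lreg c by apply: lregM; apply: (@lreg_qpoch _ K); exact: expX_nil.
apply: lc; rewrite mulrC [RHS]mulrC.
rewrite [RHS](_ : _ = theta (x ^+ 7) (x ^+ 3) K * c *
  (theta (- x ^+ 4) (- x ^+ 16) K * qpoch (x ^+ 1) (x ^+ 1) K)); last by ring.
rewrite theta_pos // !theta_neg // /c !addnE !mulnE /=.
have residue (a b : nat) : (0 < a <= b)%N -> qpoch (x ^+ a) (x ^+ b) K =
    \prod_(1 <= m < K) (if (m %% b == a %% b)%N then 1 - x ^+ m else 1).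
  by move=> ab; rewrite (qpoch_residue x_nil) // big_mkcond.
rewrite !residue // -!big_split; apply: eq_bigr => m _ /=.
(* All moduli divide 60, so which powers of 1 - x^m occur depends only on m modulo 60; each of the
   60 cases is a polynomial identity in y = x^m. *)
have mod60 d : (d %| 60)%N -> (m %% d = (m %% 60) %% d)%N by move=> d60; rewrite modn_dvdm.
rewrite (mod60 1%N) // (mod60 2%N) // (mod60 5%N) // (mod60 10%N) // (mod60 20%N) //.
move: (m %% 60)%N (ltn_pmod m (isT : 0 < 60)%N) (x ^+ m) => r lt_r y.
do 60! [case: r lt_r => [|r] lt_r /=; first ring].
by [].
Qed.

End ThetaProduct.

(** * Partition generating function *)

(** Forgets the dependent types, so that tuples of different lengths and bounds live in one type. *)
Definition tuple_vals (B l : nat) (P : pred (seq nat)) : seq (seq nat) :=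
  [seq map val (t : l.-tuple 'I_B.+1) | t <- enum [pred t : l.-tuple 'I_B.+1 | P (map val t)]].

Lemma mem_tuple_vals B l P s :
  (s \in tuple_vals B l P) = [&& size s == l, all (fun i => i <= B)%N s & P s].
Proof.
apply/mapP/and3P => [[t]|[/eqP sl /allP sB Ps]].
  rewrite mem_enum => Pt ->; split=> //; first by rewrite size_map size_tuple.
  by apply/allP => _ /mapP[i _ ->]; exact: (ltn_ord i).
have E : map val (map (inord : nat -> 'I_B.+1) s) = s.
  rewrite -map_comp map_id_in // => i /sB le_iB /=.
  by rewrite inordK.
have sz : size (map (inord : nat -> 'I_B.+1) s) == l by rewrite size_map sl.
exists (Tuple sz); last exact: esym E.
rewrite mem_enum; change (is_true (P (map val (map (inord : nat -> 'I_B.+1) s)))).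
by rewrite E.
Qed.

Lemma tuple_vals_uniq B l P : uniq (tuple_vals B l P).
Proof.
rewrite map_inj_uniq ?enum_uniq // => t u /(inj_map val_inj) E; exact: val_inj.
Qed.

Lemma leq_sumn (s : seq nat) i : i \in s -> (i <= sumn s)%N.
Proof.
elim: s => //= j s IH; rewrite inE => /predU1P[->|/IH le]; first exact: leq_addr.
exact: leq_trans le (leq_addl _ _).
Qed.

Lemma size_sumn (s : seq nat) : all (leq 1) s -> (size s <= sumn s)%N.
Proof. by elim: s => //= j s IH /andP[j0 /IH]; lia. Qed.

Lemma geq_trans : transitive geq. Proof. by move=> a b c /= h1 h2; lia. Qed.

Lemma sumn_map_succn (s : seq nat) : sumn (map succn s) = (sumn s + size s)%N.
Proof. by elim: s => //= j s ->; lia. Qed.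

(* Zero padding makes the length of the tuples independent of [m]. *)
Lemma npart_count m K : (m <= K)%N ->
  npart m = count (fun s => sumn s == m) (tuple_vals K K (sorted geq)).
Proof.
move=> le_mK.
pose pad s := s ++ nseq (K - m) 0%N.
transitivity (size (map pad (tuple_vals m m (fun s => sorted geq s && (sumn s == m))))).
  by rewrite !size_map -cardE; apply: eq_card.
rewrite -size_filter; apply/perm_size/uniq_perm.
- rewrite map_inj_in_uniq ?tuple_vals_uniq // => s t.
  rewrite !mem_tuple_vals => /and3P[/eqP ss _ _] /and3P[/eqP st _ _] /eqP.
  by rewrite eqseq_cat ?ss ?st // => /andP[/eqP].
- by rewrite filter_uniq ?tuple_vals_uniq.
move=> s; rewrite mem_filter mem_tuple_vals; apply/mapP/idP => [[t]|].
  rewrite mem_tuple_vals => /and4P[/eqP st /allP tm so /eqP su] ->.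
  rewrite /pad sumn_cat sumn_nseq su mul0n addn0 eqxx size_cat size_nseq st subnKC // eqxx /=.
  rewrite all_cat all_nseq orbT andbT; apply/andP; split.
    by apply/allP => i /tm; lia.
  move: so; rewrite !(sorted_pairwise geq_trans) pairwise_cat => ->.
  rewrite andTb; apply/andP; split; first by apply/allrelP => i j _ /nseqP[-> _].
  by elim: (K - m)%N => //= k ->; rewrite andbT all_nseq orbT.
move=> /and4P[/eqP su /eqP sz /allP sK so].
have sz_t : size (take m s) = m by rewrite size_takel ?sz.
have so' := so; rewrite -(cat_take_drop m s) (sorted_pairwise geq_trans) pairwise_cat in so'.
have /and3P[/allrelP rel so1 _] := so'.
have su' : (sumn (take m s) + sumn (drop m s) = m)%N by rewrite -sumn_cat cat_take_drop.
(* A positive entry beyond position m would force the first m entries to be at least 1, and the sum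
   to exceed m. *)
have z : drop m s = nseq (K - m) 0%N.
  rewrite -sz -size_drop; apply/all_pred1P/allP => j jd /=; rewrite -leqn0 leqNgt; apply/negP => j0.
  have := leq_sumn jd; have : (m <= sumn (take m s))%N.
    rewrite -{1}sz_t; apply: size_sumn; apply/allP => i /rel /(_ jd) /=; lia.
  lia.
have su1 : sumn (take m s) = m by move: su'; rewrite z sumn_nseq mul0n addn0.
exists (take m s); last by rewrite /pad -z cat_take_drop.
rewrite mem_tuple_vals sz_t eqxx (sorted_pairwise geq_trans) so1 su1 eqxx !andbT /=.
by apply/allP => i /leq_sumn; rewrite su1.
Qed.

Section PartitionSeries.
Variables (R : comNzRingType) (K : nat) (y : R).
Hypothesis y_nil : y ^+ K = 0.

(** Partitions into at most l parts; the bound K on the parts loses nothing modulo y^K. *)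
Let G l : R := \sum_(s <- tuple_vals K l (sorted geq)) y ^+ sumn s.

(** Either the last entry is 0 and is dropped, or all l+1 entries are positive and each is lowered
    by 1. *)
Lemma partition_step l : G l.+1 = G l + y ^+ l.+1 * G l.+1.
Proof.
transitivity (\sum_(s <- map (rcons^~ 0%N) (tuple_vals K l (sorted geq)) ++
    map (map succn) (tuple_vals K l.+1 (sorted geq))) y ^+ sumn s); last first.
  rewrite /G big_cat (big_map (rcons^~ 0%N)) (big_map (map succn)) big_distrr /=; congr (_ + _).
    by apply: eq_bigr => s _; rewrite -cats1 sumn_cat /= !addn0.
  rewrite big_seq [RHS]big_seq; apply: eq_bigr => s; rewrite mem_tuple_vals => /and3P[/eqP sz _ _].
  by rewrite sumn_map_succn sz addnC exprD.
apply: (@eq_big_supp _ _ _ _ _ _ _ (fun s => sumn s < K)%N).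
- exact: tuple_vals_uniq.
- have i0 : injective (rcons^~ 0%N) by move=> s t /rcons_inj[].
  rewrite cat_uniq (map_inj_uniq i0) (map_inj_uniq (inj_map succn_inj)) !tuple_vals_uniq andbT /=.
  apply/hasPn => _ /mapP[s _ ->]; apply/mapP => -[t _ E].
  have : 0%N \in map succn s by rewrite E mem_rcons mem_head.
  by case/mapP.
- by move=> s; rewrite -leqNgt; apply: (expr_nil y_nil).
move=> s lt_sK; rewrite mem_cat mem_tuple_vals.
have sK (t : seq nat) : (sumn t <= sumn s)%N -> all (fun i => i <= K)%N t.
  by move=> le; apply/allP => i /leq_sumn; lia.
apply/and3P/orP => [[/eqP sz _ so]|[|]/mapP[t]].
- case/lastP: s sz so lt_sK sK => // t z; rewrite size_rcons => -[sz] so lt_sK sK.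
  have := so; rewrite (sorted_pairwise geq_trans) pairwise_rcons => /andP[/allP tz so'].
  case: z tz so lt_sK sK => [|z] tz so lt_sK sK.
    left; apply/map_f; rewrite mem_tuple_vals sz eqxx (sorted_pairwise geq_trans) so' andbT sK //.
    by rewrite -cats1 sumn_cat; lia.
  have E : rcons t z.+1 = map succn (map predn (rcons t z.+1)).
    rewrite -map_comp map_id_in // => i; rewrite mem_rcons inE => /predU1P[-> //|/tz /=]; lia.
  right; rewrite {1}E; apply/map_f; rewrite mem_tuple_vals size_map size_rcons sz eqxx sK /=.
    move: so; rewrite {1}E sorted_map; apply: sub_sorted => i j; rewrite /= ltnS //.
  by have := sumn_map_succn (map predn (rcons t z.+1)); rewrite -E => ->; exact: leq_addr.
- rewrite mem_tuple_vals => /and3P[/eqP sz _ so] E; split; rewrite ?sK // E ?size_rcons ?sz //.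
  move: so; rewrite !(sorted_pairwise geq_trans) pairwise_rcons => ->; rewrite andbT.
  by apply/allP.
- rewrite mem_tuple_vals => /and3P[/eqP sz _ so] E; split; rewrite ?sK // E ?size_map ?sz //.
  by rewrite sorted_map; apply: sub_sorted so => i j; rewrite /= ltnS.
Qed.

Lemma partition_series :
  (\sum_(m < K) y ^+ m *+ npart m) * qpoch y y K = 1.
Proof.
have GE l : G l * qpoch y y l = 1.
  elim: l => [|l IH].
    rewrite /qpoch big_ord0 mulr1.
    rewrite /G (@eq_big_supp _ _ _ _ _ [:: [::]] _ predT) ?tuple_vals_uniq ?big_seq1 // => s _.
    by rewrite mem_tuple_vals inE size_eq0; case: eqP => // ->.
  have : G l.+1 * (1 - y ^+ l.+1) = G l by rewrite mulrBr mulr1 {1}partition_step; ring.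
  by rewrite qpochS -exprS => E; rewrite -[RHS]IH -E; ring.
rewrite -[RHS](GE K); congr (_ * _).
transitivity (\sum_(s <- tuple_vals K K (sorted geq)) \sum_(m < K | sumn s == m) y ^+ m).
  rewrite (exchange_big_dep xpredT) //=; apply: eq_bigr => m _.
  rewrite (@npart_count m K) 1?ltnW // big_const_seq iter_addr_0; congr (_ *+ _).
apply: eq_bigr => s _; have [lt_K|le_K] := ltnP (sumn s) K.
  by rewrite (big_pred1 (Ordinal lt_K)) // => i; rewrite eq_sym.
rewrite (expr_nil y_nil le_K) big_pred0 // => i; apply/negbTE; have := ltn_ord i; lia.
Qed.
End PartitionSeries.

(** * Coefficient extraction *)

Lemma theta_partition_identity (R : comNzRingType) (K : nat) (x : R) : x ^+ K = 0 ->
  (\sum_(m < K) x ^+ m *+ npart m) * theta (- x ^+ 1) (- x ^+ 4) K =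
  (\sum_(m < K) (x ^+ 2) ^+ m *+ npart m) * quintuple_sum x K.
Proof.
move=> x0.
set P1 := \sum_(m < K) _; set P2 := \sum_(m < K) _.
have E1 : P1 * qpoch (x ^+ 1) (x ^+ 1) K = 1 by exact: partition_series.
have E2 : P2 * qpoch (x ^+ 2) (x ^+ 2) K = 1 by apply: partition_series; exact: expX_nil.
(* A regular factor: its first two symbols cancel [P1] and [P2], and [theta_product] with
   [theta_lattice] matches the rest. *)
pose c := qpoch (x ^+ 1) (x ^+ 1) K * qpoch (x ^+ 2) (x ^+ 2) K * theta (- x ^+ 40) (- x ^+ 20) K.
have lc : GRing.lreg c.
  rewrite /c theta_neg //; repeat apply: lregM; apply: (@lreg_qpoch _ K); exact: expX_nil.
apply: lc.
have F1 := theta_product x0; have F2 := theta_lattice x0.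
transitivity (P1 * qpoch (x ^+ 1) (x ^+ 1) K * (theta (- x ^+ 1) (- x ^+ 4) K *
   qpoch (x ^+ 2) (x ^+ 2) K * theta (- x ^+ 40) (- x ^+ 20) K)); first by rewrite /c; ring.
rewrite F1 E1 F2 mul1r -[LHS]mul1r -E2 /c; ring.
Qed.

(** The ring is Z[X]/(X^K), and [phi] reads off the coefficient of X^n. *)
Lemma truncated_series_ring (n K : nat) : (n < K)%N ->
  exists (R : comNzRingType) (x : R) (phi : {additive R -> int}),
    x ^+ K = 0 /\ forall m, phi (x ^+ m) = (m == n)%:R.
Proof.
case: K => // K lt_nK.
pose h : {poly int} := 'X^(K.+1).
have hE : mk_monic h = 'X^(K.+1) by rewrite mk_monic_Xn.
have small m : (m < K.+1)%N -> ('qX : {poly %/ h}) ^+ m = 'X^m :> {poly int}.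
  by move=> lt_m; rewrite -rmorphXn /= Pdiv.CommonRing.rmodp_small // hE !size_polyXn.
have x0 : ('qX : {poly %/ h}) ^+ K.+1 = 0.
  apply: val_inj; rewrite -rmorphXn /= hE; by apply: Pdiv.RingMonic.rmodpp; exact: monicXn.
exists {poly %/ h}, 'qX, (coefp n \o val); split=> // m /=.
have [lt_m|le_m] := ltnP m K.+1; first by rewrite small // coefXn eq_sym.
by rewrite (expr_nil x0 le_m) coef0; case: eqP lt_nK le_m => // ->; lia.
Qed.

Lemma p_neg (z : int) : z < 0 -> p z = 0. Proof. by case: z. Qed.

Section CoefficientExtraction.
Variables (R : comNzRingType) (n K : nat) (x : R) (phi : {additive R -> int}).
Hypothesis lt_nK : (n < K)%N.
Hypothesis phiX : forall m, phi (x ^+ m) = (m == n)%:R.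

Lemma coef_partition (d e : nat) : (0 < d)%N ->
  phi ((\sum_(m < K) (x ^+ d) ^+ m *+ npart m) * x ^+ e) =
  if (d%:Z %| n%:Z - e%:Z)%Z then p (divz (n%:Z - e%:Z) d) else 0.
Proof.
move=> d0; rewrite big_distrl raddf_sum /=.
under eq_bigr => m _ do rewrite mulrnAl raddfMn /= -exprM -exprD phiX.
have zero : (forall m : 'I_K, (d * m + e == n)%N = false) ->
    \sum_(m < K) (d * m + e == n)%:R *+ npart m = 0 :> int.
  by move=> h; rewrite big1 // => m _; rewrite h mul0rn.
have [le_en|lt_ne] := leqP e n; last first.
  rewrite zero => [|m]; last by apply/negbTE; lia.
  case: ifP => // /dvdzP[q qE].
  by rewrite qE mulzK ?p_neg //; nia.
rewrite subzn // dvdzE /= divz_nat.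
have [/dvdnP[q qE]|ndvd] := boolP (d %| n - e)%N; last first.
  rewrite zero // => m; apply/negbTE/negP => /eqP E; case/negP: ndvd.
  by rewrite -E addnK dvdn_mulr.
have lt_qK : (q < K)%N by nia.
rewrite qE mulnK // (bigD1 (Ordinal lt_qK)) //= big1 => [|m ne_mq].
  have -> : (d * q + e == n)%N by apply/eqP; lia.
  by rewrite addr0 -[RHS]/((npart q)%:Z) -natz.
rewrite (_ : (_ == n) = false) ?mul0rn //; apply/negP => /eqP E.
by case/eqP: ne_mq; apply: val_inj => /=; nia.
Qed.

Let theta_exp (j : int) : int := divz (j * (5 * j - 3)) 2.

Lemma theta_expE j : 2 * theta_exp j = j * (5 * j - 3).
Proof.
rewrite /theta_exp mulrC divzK //.
(* Since j(5j-3) = 5j(j+1) - 8j, the bracket is j(5j-3) minus its own half. *)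
have -> : j * (5 * j - 3) = 2 * (j * (5 * j - 3) - 5 * (tri j)%:Z + 4 * j) + (j - j).
  have := triE j; nia.
by rewrite subrr addr0 dvdz_mulr.
Qed.

Lemma coef_theta : (0 < K)%N ->
  phi ((\sum_(m < K) x ^+ m *+ npart m) * theta (- x ^+ 1) (- x ^+ 4) K) = Lsum n K.
Proof.
move=> K0; rewrite /theta big_distrr raddf_sum /=.
pose G j : int := (-1) ^+ absz j * p (n%:Z - theta_exp j).
transitivity (\sum_(j <- zrange K) G j).
  apply: eq_bigr => j _; rewrite theta_term_expNX mulrCA raddfMsign /G; congr (_ * _).
  have := @coef_partition 1 (1 * tri j + 4 * tri (- j)) isT.
  rewrite expr1 dvd1z divz1 => ->; congr (p (_ - _)).
  have := theta_expE j; have := triE j; have := triE (- j); nia.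
have G0 : p n = G 0 by rewrite /G /theta_exp mul0r div0z subr0 mul1r.
(* The indices k and -k give the exponents k(5k-3)/2 and k(5k+3)/2 of [Lsum]. *)
transitivity (\sum_(j <- 0 :: map Posz (index_iota 1 K) ++ map (fun k => - Posz k) (index_iota 1 K)) G j); last first.
  rewrite big_cons big_cat !big_map /Lsum G0 /= -big_split /=; congr (_ + _).
  apply: eq_bigr => k _; rewrite /G abszN mulrDr; congr (_ + _ * p (_ - _)).
  by rewrite /theta_exp; congr (divz _ _); ring.
(* The range on the left also contains j = K and j = -K; their exponents exceed n because n < K. *)
apply: (@eq_big_supp _ _ _ _ _ _ _ (fun j => theta_exp j <= n%:Z)).
- exact: zrange_uniq.
- have iP : injective Posz by move=> a b [].
  have iN : injective (fun k => - Posz k) by move=> a b; lia.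
  rewrite cons_uniq mem_cat cat_uniq (map_inj_uniq iP) (map_inj_uniq iN) !iota_uniq !andTb andbT.
  apply/andP; split.
    by apply/negP => /orP[] /mapP[k]; rewrite mem_index_iota; lia.
  by apply/hasPn => z /mapP[k]; rewrite mem_index_iota => k0 ->; apply/mapP => -[l]; rewrite mem_index_iota; lia.
- by move=> j lt; rewrite /G p_neg ?mulr0 //; lia.
move=> j le_n; rewrite mem_zrange inE mem_cat.
have jK : (absz j < K)%N by have := theta_expE j; nia.
rewrite ltnW //; symmetry; apply/or3P.
have [E|[E|E]] : j = 0 \/ j = Posz (absz j) /\ j != 0 \/ j = - Posz (absz j) /\ j != 0 by lia.
- by constructor 1; rewrite E.
- by constructor 2; rewrite E.1; apply/map_f; rewrite mem_index_iota; lia.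
- by constructor 3; rewrite E.1; apply/(map_f (fun k => - Posz k)); rewrite mem_index_iota; lia.
Qed.

Lemma coef_quintuple :
  phi ((\sum_(m < K) (x ^+ 2) ^+ m *+ npart m) * quintuple_sum x K) =
  \sum_(i <- zrange K)
    let c (f : int) := if (2 %| n%:Z - f)%Z then p (divz (n%:Z - f) 2) else 0 in
    c (re i) - c (se i) - c (ro i) + c (so i).
Proof.
rewrite /quintuple_sum big_distrr raddf_sum /=; apply: eq_bigr => i _.
rewrite mulrDr 2!mulrBr raddfD 2!raddfB /= !coef_partition //.
have i2 : `|i| <= i ^+ 2 by nia.
have re0 : 0 <= re i by rewrite /re; lia.
have ro0 : 0 <= ro i by rewrite /ro; lia.
have se0 : 0 <= se i by rewrite /se; lia.
have so0 : 0 <= so i by rewrite /so; lia.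
by rewrite (gez0_abs re0) (gez0_abs ro0) (gez0_abs se0) (gez0_abs so0).
Qed.
End CoefficientExtraction.

Theorem theorem3 (n : int) (N : nat) : (`|n| < N)%N ->
  ((2 %| n)%Z ->
     Lsum n N = zsum N (fun i => p ((n - re i) %/ 2)%Z - p ((n - se i) %/ 2)%Z)) /\
  (~~ (2 %| n)%Z ->
     Lsum n N = zsum N (fun i => - p ((n - ro i) %/ 2)%Z + p ((n - so i) %/ 2)%Z)).
Proof.
have zsumE F : zsum N F = \sum_(i <- zrange N) F i.
  by rewrite /zsum /zrange big_map -[iota _ _]/(index_iota 0 (2 * N).+1) big_mkord.
(* For negative n every argument of [p] is negative, so both sides are 0. *)
rewrite !zsumE; case: n => n lt_nN; last first.
  have sq (i : int) : `|i| <= i ^+ 2 by nia.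
  have L0 : Lsum (Negz n) N = 0.
    rewrite /Lsum p_neg // add0r big_nat_cond big1 // => j /andP[/andP[j0 _] _].
    by rewrite !p_neg ?addr0 ?mulr0 //; nia.
  have half_neg (f : int) : 0 <= f -> p (divz (Negz n - f) 2) = 0 by move=> f0; rewrite p_neg //; lia.
  by split=> _; rewrite L0; symmetry; apply: big1 => i _; have := sq i => i2;
    rewrite !half_neg ?subrr ?oppr0 ?addr0 // ?/re ?/ro ?/se ?/so; lia.
have [R [x [phi [x0 phiX]]]] := @truncated_series_ring n N lt_nN.
rewrite -(coef_theta lt_nN phiX) ?(leq_ltn_trans _ lt_nN) // theta_partition_identity //.
rewrite (coef_quintuple lt_nN phiX).
(* [re] and [se] are even, [ro] and [so] odd, so exactly two of the four terms survive for each
   parity of n. *)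
have parity (i : int) : [/\ (2 %| n%:Z - re i)%Z = (2 %| n%:Z)%Z, (2 %| n%:Z - se i)%Z = (2 %| n%:Z)%Z,
    (2 %| n%:Z - ro i)%Z = ~~ (2 %| n%:Z)%Z & (2 %| n%:Z - so i)%Z = ~~ (2 %| n%:Z)%Z].
  by rewrite /re /se /ro /so; move: (i ^+ 2) => i2; split; lia.
split=> par; apply: eq_bigr => i _ /=; have [-> -> -> ->] := parity i.
- by rewrite par /= subr0 addr0.
- by rewrite (negbTE par) /= subr0 sub0r.
Qed.
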